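(* Let $\kappa_0,\kappa_1,\kappa_\infty\in\mathbb C$ and $\rho=\frac{(\kappa_0+\kappa_1-1)^2-\kappa_\infty^2}{4}$. On the boundary component $\mathcal A_0$, the restricted Hamiltonian vector field of the fifth Painlevé equation is, in the coordinates $(q,P^0)$ and $(\tilde q,P^1_0)$ respectively, $$X^V_{\mathcal A_0}(q,P^0)=2q(q-1)\Big(\big(P^0-\tfrac{\kappa_0}{2}\big)(q-1)-\tfrac{\kappa_1-1}{2}q\Big)\partial_q+\Big(P^0(P^0-\kappa_0)-\big((P^0)^2-(\kappa_0+\kappa_1-1)P^0+\rho\big)q^2\Big)\partial_{P^0},$$ $$X^V_{\mathcal A_0}(\tilde q,P^1_0)=\tilde q(\tilde q+1)\big(\kappa_0\tilde q+(\kappa_1-1)(\tilde q+1)-2P^1_0\big)\partial_{\tilde q}+\tilde q\big((\tilde q+1)^2\rho-P^1_0(P^1_0+\kappa_0)\big)\partial_{P^1_0}.$$ The residual spectral data at the node, $$q\big((P^0)^2-(\kappa_0+\kappa_1-1)P^0+\rho\big)-2(P^0)^2+(2\kappa_0+\kappa_1-1)P^0-\rho+\Big(\frac{\kappa_1}{2}\Big)^2+\frac{P^0(P^0-\kappa_0)}{q}$$ and $$\frac{4P^1_0(P^1_0+\kappa_0)}{\tilde q+1}+4(-\kappa_0-\kappa_1+1)P^1_0+4\rho\tilde q+\kappa_1^2,$$ are first integrals of the respective vector fields, i.e. they are annihilated by them.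
   Context: The Hamiltonian vector field of the fifth Painlevé equation is $X^V=\partial_t+\frac{\partial H^V}{\partial p}\partial_q-\frac{\partial H^V}{\partial q}\partial_p$ with $$H^V=\frac{q(q-1)^2p^2-\big(\kappa_0(q-1)^2+(\kappa_1-1)q(q-1)-tq\big)p+\rho(q-1)}{t}.$$ Coordinates: $\tilde q=q-1$, $A=\frac{t}{q-1}$, $P^0=pq$, $P^1_0=pq(q-1)$. The component $\mathcal A_0$ corresponds to $t=0$: it is $\{t=0\}$ in the coordinates $(t,q,P^0)$ and $\{A=0\}$ in the coordinates $(A,\tilde q,P^1_0)$. The restricted vector field is the limit of $X^V$, rescaled by a function, written in these coordinates: the limit as $t\to0$ of $q\,t\,X^V$ in coordinates $(t,q,P^0)$, and the limit as $A\to0$ of $-q\,t\,X^V$ in coordinates $(A,\tilde q,P^1_0)$. The two displayed functions are the residual spectral data at the node of the limit connection, which lives on a nodal curve. *)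

(* Defs.v *)
From mathcomp Require Import all_boot all_order all_algebra.
From mathcomp Require Export complex.
From mathcomp Require Export all_classical all_reals all_analysis.

Set Implicit Arguments.
Unset Strict Implicit.
Unset Printing Implicit Defensive.

Import Order.TTheory GRing.Theory Num.Theory.
Import numFieldNormedType.Exports.

Local Open Scope classical_set_scope.
Local Open Scope ring_scope.

(* Everything is written over a numFieldType [K], to be instantiated by the
   complex numbers [R[i]]; derivatives are then complex (holomorphic) ones,
   since the increments range over [K].  A vector field on K^2 or K^3 is given
   by its components in the standard coordinates. *)

Section VectorFields.
Variable K : numFieldType.

Definition pushforward (V W : normedModType K) (phi : V -> W) (psi : W -> V)
    (X : V -> V) : W -> W :=
  fun y => 'd phi (psi y) (X (psi y)).

(* [Y] is defined on the subset [D] of K^3; its extension to the boundary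
   {y.1.1 = 0} is tangent to it and equal to [Z] there.  The limit is taken
   jointly in all coordinates, inside [D]: it yields in particular the limit
   along the first coordinate with the two others fixed, and it also makes
   sense at the boundary points where this line does not meet [D]. *)
Definition restricts_to (D : set (K * K * K)) (Y : K * K * K -> K * K * K)
    (Z : K * K -> K * K) : Prop :=
  forall a b : K,
    Y y @[y --> within D (nbhs (0, a, b))] --> (0, (Z (a, b)).1, (Z (a, b)).2).

(* Differentiability is required because ['D_v I z] is a default value when
   the limit defining it does not exist. *)
Definition first_integral (D : set (K * K)) (X : K * K -> K * K)
    (I : K * K -> K) : Prop :=
  forall z, D z -> differentiable I z /\ 'D_(X z) I z = 0.

End VectorFields.

Section PainleveV.
Variable K : numFieldType.

Definition PV_rho (k0 k1 koo : K) : K := ((k0 + k1 - 1) ^+ 2 - koo ^+ 2) / 4.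

Definition HV (k0 k1 rho : K) (x : K * K * K) : K :=
  let: (t, q, p) := x in
  (q * (q - 1) ^+ 2 * p ^+ 2
   - (k0 * (q - 1) ^+ 2 + (k1 - 1) * q * (q - 1) - t * q) * p
   + rho * (q - 1)) / t.

Definition XV (k0 k1 rho : K) (x : K * K * K) : K * K * K :=
  (1, 'D_(0, 0, 1) (HV k0 k1 rho) x, - 'D_(0, 1, 0) (HV k0 k1 rho) x).

(* (t, q, p) |-> (t, q, P^0) *)
Definition chart0 (x : K * K * K) : K * K * K :=
  let: (t, q, p) := x in (t, q, p * q).

Definition chart0_inv (y : K * K * K) : K * K * K :=
  let: (t, q, P) := y in (t, q, P / q).

Definition chart0_dom : set (K * K * K) :=
  [set y | y.1.1 != 0 /\ y.1.2 != 0].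

(* (t, q, p) |-> (A, q - 1, P^1_0) *)
Definition chart1 (x : K * K * K) : K * K * K :=
  let: (t, q, p) := x in (t / (q - 1), q - 1, p * q * (q - 1)).

Definition chart1_inv (y : K * K * K) : K * K * K :=
  let: (A, u, P) := y in (A * u, u + 1, P / ((u + 1) * u)).

(* the image of t <> 0, q <> 0, q <> 1 *)
Definition chart1_dom : set (K * K * K) :=
  [set y | [/\ y.1.1 != 0, y.1.2 != 0 & y.1.2 + 1 != 0]].

Lemma chart0K t q p : q != 0 -> chart0_inv (chart0 (t, q, p)) = (t, q, p).
Proof. by move=> q0; rewrite /= mulfK. Qed.

Lemma chart0_invK y : chart0_dom y -> chart0 (chart0_inv y) = y.
Proof. by case: y => [[t q] P] [/= _ q0]; rewrite /= divfK. Qed.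

Lemma chart1K t q p : q != 0 -> q != 1 ->
  chart1_inv (chart1 (t, q, p)) = (t, q, p).
Proof.
move=> q0; rewrite -subr_eq0 => q1.
by rewrite /= divfK // subrK -(mulrA p) mulfK // mulf_neq0.
Qed.

Lemma chart1_invK y : chart1_dom y -> chart1 (chart1_inv y) = y.
Proof.
case: y => [[A u] P] [/= _ u0 u1].
by rewrite /= addrK mulfK // -[_ * _ * u]mulrA divfK // mulf_neq0.
Qed.

Definition XV_chart0 (k0 k1 rho : K) : K * K * K -> K * K * K :=
  pushforward chart0 chart0_inv
    (fun x => (x.1.2 * x.1.1) *: XV k0 k1 rho x).

Definition XV_chart1 (k0 k1 rho : K) : K * K * K -> K * K * K :=
  pushforward chart1 chart1_inv
    (fun x => (- (x.1.2 * x.1.1)) *: XV k0 k1 rho x).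

Definition XA0_chart0 (k0 k1 rho : K) (z : K * K) : K * K :=
  let: (q, P) := z in
  (2 * q * (q - 1) * ((P - k0 / 2) * (q - 1) - (k1 - 1) / 2 * q),
   P * (P - k0) - (P ^+ 2 - (k0 + k1 - 1) * P + rho) * q ^+ 2).

Definition XA0_chart1 (k0 k1 rho : K) (z : K * K) : K * K :=
  let: (u, P) := z in
  (u * (u + 1) * (k0 * u + (k1 - 1) * (u + 1) - 2 * P),
   u * ((u + 1) ^+ 2 * rho - P * (P + k0))).

Definition node_data0 (k0 k1 rho : K) (z : K * K) : K :=
  let: (q, P) := z in
  q * (P ^+ 2 - (k0 + k1 - 1) * P + rho)
  - 2 * P ^+ 2 + (2 * k0 + k1 - 1) * P - rho + (k1 / 2) ^+ 2
  + P * (P - k0) / q.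

Definition node_data1 (k0 k1 rho : K) (z : K * K) : K :=
  let: (u, P) := z in
  4 * P * (P + k0) / (u + 1) + 4 * (- k0 - k1 + 1) * P + 4 * rho * u + k1 ^+ 2.

End PainleveV.

(* Main.v *)
(* Each rescaled, pushed-forward field agrees on the domain of its chart with a
   polynomial vector field on K^3, so its limit on the boundary is the value of
   that polynomial field there.

   Each restricted field is Hamiltonian for its node data I, up to a factor:
   (q^2 I_P, - q^2 I_q) in the first chart and
   (u (u+1)^2 / 4) (- I_P, I_u) in the second; hence it annihilates I. *)
Require Import Defs.
From mathcomp Require Import all_boot all_order all_algebra.
From mathcomp Require Import ring.

Set Implicit Arguments.
Unset Strict Implicit.

Import Order.TTheory GRing.Theory Num.Theory.
Import numFieldNormedType.Exports.
Local Open Scope classical_set_scope.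
Local Open Scope ring_scope.

Section PointwiseDifferentials.
Variables (K : numFieldType) (V : normedModType K).

(** [fst] is linear and continuous, so it is its own differential. Composing with [f] lets nested
    projections such as [y.1.2] be peeled off one at a time. *)
Lemma is_diff_fst (W W' : normedModType K) (f df : V -> W * W') x :
  is_diff x f df -> is_diff x (fun y => (f y).1) (fun v => (df v).1).
Proof.
move=> dfx; apply: is_diff_comp; apply: DiffDef.
  by apply: (@linear_differentiable _ _ _ fst) => ?; apply: cvg_fst.
by rewrite (@diff_lin _ _ _ fst) // => ?; apply: cvg_fst.
Qed.

Lemma is_diff_snd (W W' : normedModType K) (f df : V -> W * W') x :
  is_diff x f df -> is_diff x (fun y => (f y).2) (fun v => (df v).2).
Proof.
move=> dfx; apply: is_diff_comp; apply: DiffDef.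
  by apply: (@linear_differentiable _ _ _ snd) => ?; apply: cvg_snd.
by rewrite (@diff_lin _ _ _ snd) // => ?; apply: cvg_snd.
Qed.

(* The library states these rules in the ring of functions (f + g, f * g, f ^+ n);
   the forms below unify with a lambda-abstracted expression. *)
Lemma is_diff_fun_cst (W : normedModType K) (a : W) x :
  is_diff x (fun _ : V => a) (fun _ => 0).
Proof. exact: is_diff_cst. Qed.

Lemma is_diff_fun_add (f g df dg : V -> K) x :
  is_diff x f df -> is_diff x g dg ->
  is_diff x (fun y => f y + g y) (fun v => df v + dg v).
Proof. exact: is_diffD. Qed.

Lemma is_diff_fun_opp (f df : V -> K) x :
  is_diff x f df -> is_diff x (fun y => - f y) (fun v => - df v).
Proof. exact: is_diffN. Qed.

Lemma is_diff_fun_mul (f g df dg : V -> K) x :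
  is_diff x f df -> is_diff x g dg ->
  is_diff x (fun y => f y * g y) (fun v => f x * dg v + g x * df v).
Proof. exact: is_diffM. Qed.

Lemma is_diff_fun_exp (f df : V -> K) n x :
  is_diff x f df ->
  is_diff x (fun y => f y ^+ n.+1) (fun v => n.+1%:R * f x ^+ n * df v).
Proof. by move=> dfx; have := is_diffX n dfx; rewrite exprfctE. Qed.

Lemma is_diff_fun_inv (f df : V -> K) x :
  f x != 0 -> is_diff x f df ->
  is_diff x (fun y => (f y)^-1) (fun v => - (f x) ^- 2 * df v).
Proof.
move=> fx0 dfx; apply: DiffDef; first exact: differentiableV.
by rewrite diffV// diff_val.
Qed.

(** Here and in the next two lemmas [df] can be left as an existential variable, which
    [differentiate] instantiates. *)
Lemma is_diff_differentiable (W : normedModType K) (f df : V -> W) x :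
  is_diff x f df -> differentiable f x.
Proof. by []. Qed.

Lemma is_diff_diff (W : normedModType K) (f df : V -> W) x v :
  is_diff x f df -> 'd f x v = df v.
Proof. by move=> dfx; rewrite diff_val. Qed.

Lemma is_diff_derive (W : normedModType K) (f df : V -> W) x v :
  is_diff x f df -> 'D_v f x = df v.
Proof. by move=> dfx; rewrite deriveE// diff_val. Qed.

End PointwiseDifferentials.

(** The nonvanishing conditions raised by inverses remain as goals, for the enclosing [by] to close
    from the context. *)
Ltac differentiate :=
  repeat first
    [ exact: is_diff_fun_cst | exact: is_diff_id
    | eapply is_diff_fun_add | eapply is_diff_fun_opp | eapply is_diff_fun_exp
    | eapply is_diff_fun_mul | eapply is_diff_fun_inv
    | eapply is_diff_pair | eapply is_diff_fst | eapply is_diff_snd ].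

Section PainleveV.
Variables (K : numFieldType) (k0 k1 rho : K).
Local Notation H := (HV k0 k1 rho).

(** With H = N / t, the coefficients of [v] are N_p / t, N_q / t and N_t / t - H / t, where N_t = q
    p. *)
Lemma derive_HV (t q p : K) (v : K * K * K) : t != 0 ->
  'D_v H (t, q, p) =
  (2 * q * (q - 1) ^+ 2 * p - k0 * (q - 1) ^+ 2 - (k1 - 1) * q * (q - 1)
     + t * q) / t * v.2
  + ((q - 1) * (3 * q - 1) * p ^+ 2
     - (2 * k0 * (q - 1) + (k1 - 1) * (2 * q - 1) - t) * p + rho) / t * v.1.2
  + (q * p / t - H (t, q, p) / t) * v.1.1.
Proof.
move=> t0.
(* Projections replace pattern matching, so that the differentiation rules unify. *)
have -> : H = fun x => (x.1.2 * (x.1.2 - 1) ^+ 2 * x.2 ^+ 2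
   - (k0 * (x.1.2 - 1) ^+ 2 + (k1 - 1) * x.1.2 * (x.1.2 - 1)
      - x.1.1 * x.1.2) * x.2
   + rho * (x.1.2 - 1)) * (x.1.1)^-1.
  by apply/funext => -[[? ?] ?].
erewrite is_diff_derive; last by differentiate.
by case: v => [[v1 v2] v3] /=; field.
Qed.

Lemma diff_chart0 (t q p : K) v :
  'd (@chart0 K) (t, q, p) v = (v.1.1, v.1.2, p * v.1.2 + q * v.2).
Proof.
have -> : @chart0 K = fun x => (x.1.1, x.1.2, x.2 * x.1.2).
  by apply/funext => -[[? ?] ?].
by erewrite is_diff_diff; last by differentiate.
Qed.

Lemma diff_chart1 (t q p : K) v : q != 1 ->
  'd (@chart1 K) (t, q, p) v =
  (v.1.1 / (q - 1) - t / (q - 1) ^+ 2 * v.1.2, v.1.2,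
   p * (2 * q - 1) * v.1.2 + q * (q - 1) * v.2).
Proof.
rewrite -subr_eq0 => q1.
have -> : @chart1 K =
    fun x => (x.1.1 / (x.1.2 - 1), x.1.2 - 1, x.2 * x.1.2 * (x.1.2 - 1)).
  by apply/funext => -[[? ?] ?].
erewrite is_diff_diff; last by differentiate.
by case: v => [[v1 v2] v3] /=; congr (_, _, _); field.
Qed.

(** The limit within [D] sees [Y] only where it equals [G], and [G] is continuous at the boundary
    because it is differentiable there. *)
Lemma restricts_to_differentiable (D : set (K * K * K)) (Y G : K * K * K -> K * K * K)
    (Z : K * K -> K * K) :
  (forall y, D y -> Y y = G y) ->
  (forall a b : K, differentiable G (0, a, b)) ->
  (forall a b, G (0, a, b) = (0, (Z (a, b)).1, (Z (a, b)).2)) ->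
  restricts_to D Y Z.
Proof.
move=> YG Gdiff GZ a b; rewrite -GZ => B.
move=> /(differentiable_continuous (Gdiff a b)) GB.
apply: (@filterS _ (nbhs ((0 : K), a, b)) _ (G @^-1` B)) => // y GyB Dy.
by rewrite /= YG.
Qed.

Lemma XV_chart0_restricts :
  restricts_to (@chart0_dom _) (XV_chart0 k0 k1 rho) (XA0_chart0 k0 k1 rho).
Proof.
(* The term t q p of the numerator of H generates a flow preserving P = p q, so its only trace is t
   q^2 in the second component. *)
apply: (@restricts_to_differentiable _ _ (fun y =>
  (y.1.2 * y.1.1,
   2 * y.1.2 * (y.1.2 - 1) *
     ((y.2 - k0 / 2) * (y.1.2 - 1) - (k1 - 1) / 2 * y.1.2)
     + y.1.1 * y.1.2 ^+ 2,
   y.2 * (y.2 - k0)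
     - (y.2 ^+ 2 - (k0 + k1 - 1) * y.2 + rho) * y.1.2 ^+ 2))).
- move=> [[t q] P] [/= t0 q0].
  rewrite /XV_chart0 /pushforward /chart0_inv /XV diff_chart0 !derive_HV//= /GRing.scale/=.
  by congr (_, _, _); field; rewrite ?t0 ?q0.
- by move=> a b; eapply (@is_diff_differentiable _ (K * K * K)%type (K * K * K)%type);
    differentiate.
- by move=> a b /=; rewrite mulr0 mul0r addr0.
Qed.

Lemma XV_chart1_restricts :
  restricts_to (@chart1_dom _) (XV_chart1 k0 k1 rho) (XA0_chart1 k0 k1 rho).
Proof.
(* The first component is A' = t' / u - A u' / u with t' = - (u + 1) u A; since u divides u', it is
   a multiple of A. The flow of t q p preserves p q = P / u, so its contributions to u' and P' are u
   and P times the same factor - A (u + 1)^2. *)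
apply: (@restricts_to_differentiable _ _ (fun y =>
  (y.1.1 * ((y.1.2 + 1) *
     (2 * y.2 - k0 * y.1.2 - (k1 - 1) * (y.1.2 + 1)
      + y.1.1 * (y.1.2 + 1) - 1)),
   y.1.2 * (y.1.2 + 1) * (k0 * y.1.2 + (k1 - 1) * (y.1.2 + 1) - 2 * y.2)
     - y.1.1 * y.1.2 * (y.1.2 + 1) ^+ 2,
   y.1.2 * ((y.1.2 + 1) ^+ 2 * rho - y.2 * (y.2 + k0))
     - y.1.1 * (y.1.2 + 1) ^+ 2 * y.2))).
- move=> [[A u] P] [/= A0 u0 u1].
  have q1 : u + 1 != 1 by rewrite -subr_eq0 addrK.
  rewrite /XV_chart1 /pushforward /chart1_inv /XV diff_chart1//.
  rewrite !derive_HV ?mulf_neq0//= /GRing.scale/= !addrK.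
  by congr (_, _, _); field; rewrite ?A0 ?u0 ?u1.
- by move=> a b; eapply (@is_diff_differentiable _ (K * K * K)%type (K * K * K)%type);
    differentiate.
- by move=> a b /=; rewrite !mul0r !subr0.
Qed.

(** The first premise determines [dI] by differentiation; the second is then a rational identity
    left to [field]. *)
Lemma first_integral_is_diff (D : set (K * K)) X I dI :
  (forall z, D z -> is_diff z I (dI z)) ->
  (forall z, D z -> dI z (X z) = 0) -> first_integral D X I.
Proof.
move=> dIP dI0 z Dz; have dIz := dIP z Dz; split; first exact: ex_diff.
by rewrite (is_diff_derive _ dIz) dI0.
Qed.

Lemma node_data0_first_integral :
  first_integral [set z : K * K | z.1 != 0]
    (XA0_chart0 k0 k1 rho) (node_data0 k0 k1 rho).
Proof.
have -> : node_data0 k0 k1 rho = fun z : K * K =>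
    z.1 * (z.2 ^+ 2 - (k0 + k1 - 1) * z.2 + rho)
    - 2 * z.2 ^+ 2 + (2 * k0 + k1 - 1) * z.2 - rho + (k1 / 2) ^+ 2
    + z.2 * (z.2 - k0) / z.1.
  by apply/funext => -[].
eapply first_integral_is_diff => [z z0|[q P] /= q0]; first by differentiate.
by rewrite /=; field.
Qed.

Lemma node_data1_first_integral :
  first_integral [set z : K * K | z.1 + 1 != 0]
    (XA0_chart1 k0 k1 rho) (node_data1 k0 k1 rho).
Proof.
have -> : node_data1 k0 k1 rho = fun z : K * K =>
    4 * z.2 * (z.2 + k0) / (z.1 + 1) + 4 * (- k0 - k1 + 1) * z.2
    + 4 * rho * z.1 + k1 ^+ 2.
  by apply/funext => -[].
eapply first_integral_is_diff => [z z0|[u P] /= u1]; first by differentiate.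
by rewrite /=; field.
Qed.

End PainleveV.

Theorem proposition2p6 (R : realType) (k0 k1 koo rho : R[i])
    (hrho : rho = PV_rho k0 k1 koo) :
  [/\ restricts_to (@chart0_dom _) (XV_chart0 k0 k1 rho)
        (XA0_chart0 k0 k1 rho),
      restricts_to (@chart1_dom _) (XV_chart1 k0 k1 rho)
        (XA0_chart1 k0 k1 rho),
      first_integral [set z : R[i] * R[i] | z.1 != 0]
        (XA0_chart0 k0 k1 rho) (node_data0 k0 k1 rho)
    & first_integral [set z : R[i] * R[i] | z.1 + 1 != 0]
        (XA0_chart1 k0 k1 rho) (node_data1 k0 k1 rho)].
Proof.
split.
- exact: XV_chart0_restricts.
- exact: XV_chart1_restricts.
- exact: node_data0_first_integral.
- exact: node_data1_first_integral.
Qed.
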